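(* Let $G_1$ and $G_2$ be Clique-Helly graphs, neither of which is $K_1$, and let $G=G_1\Box G_2$. Then $K^2(G)\cong G$.
   Context: Graphs are simple. A clique of a graph is a maximal complete subgraph. For a graph $H$, the clique graph $K(H)$ has as vertex set the set of all cliques of $H$, two distinct cliques being adjacent iff they share at least one vertex; $K^2(H)=K(K(H))$. A graph is Clique-Helly if every family of pairwise intersecting cliques has nonempty total intersection. The Cartesian product $G_1\Box G_2$ has vertex set $V(G_1)\times V(G_2)$, with $(g_1,h_1)$ adjacent to $(g_2,h_2)$ iff either $g_1g_2\in E(G_1)$ and $h_1=h_2$, or $g_1=g_2$ and $h_1h_2\in E(G_2)$. $K_1$ is the graph with one vertex.
   Formalization: Neither graph may have an isolated vertex (automatic for connected graphs other than K_1); as stated the claim fails for G_1 = 2K_1, G_2 = P_3, where G = 2P_3 but K^2(G) = 2K_1. *)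

(* Defs.v *)
From mathcomp Require Import all_boot.
From mathcomp Require Import classical_sets.
From Stdlib Require Import Relations.

Set Implicit Arguments.
Unset Strict Implicit.
Unset Printing Implicit Defensive.

Local Open Scope classical_set_scope.

(* Graphs may be infinite. *)
Record sgraph : Type := SGraph {
  vertex :> Type;
  adj : vertex -> vertex -> Prop;
  adj_sym : forall x y, adj x y -> adj y x;
  adj_irrefl : forall x, ~ adj x x }.

Arguments adj {s} x y.

Definition isomorphic (G H : sgraph) : Prop :=
  exists f : G -> H, bijective f /\ forall x y, adj (f x) (f y) <-> adj x y.

Definition K1 : sgraph :=
  @SGraph unit (fun _ _ => False) (fun _ _ h => h) (fun _ h => h).

Definition complete (G : sgraph) (A : set G) : Prop :=
  forall x y, A x -> A y -> x <> y -> adj x y.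

(* A complete subgraph is determined by its vertex set, so cliques are
   represented as vertex sets. *)
Definition clique (G : sgraph) (A : set G) : Prop :=
  complete A /\ forall B : set G, complete B -> A `<=` B -> B = A.

Section CliqueGraph.
Variable G : sgraph.

Definition clique_adj (A B : {A : set G | clique A}) : Prop :=
  A <> B /\ (sval A `&` sval B) !=set0.

Lemma clique_adj_sym A B : clique_adj A B -> clique_adj B A.
Proof. by case=> neqAB; rewrite setIC => ?; split=> // /esym. Qed.

Lemma clique_adj_irrefl A : ~ clique_adj A A.
Proof. by case. Qed.

Definition clique_graph : sgraph := SGraph clique_adj_sym clique_adj_irrefl.
End CliqueGraph.

(* The intersection of the empty family is the whole vertex set; hence a
   Clique-Helly graph has at least one vertex. *)
Definition clique_helly (G : sgraph) : Prop :=
  forall F : set (set G),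
    F `<=` @clique G ->
    (forall A B, F A -> F B -> (A `&` B) !=set0) ->
    (\bigcap_(A in F) A) !=set0.

Section CartesianProduct.
Variables G1 G2 : sgraph.

Definition box_adj (x y : G1 * G2) : Prop :=
  (adj x.1 y.1 /\ x.2 = y.2) \/ (x.1 = y.1 /\ adj x.2 y.2).

Lemma box_adj_sym x y : box_adj x y -> box_adj y x.
Proof. by case=> -[]; [left|right]; split=> //; apply: adj_sym. Qed.

Lemma box_adj_irrefl x : ~ box_adj x x.
Proof. by case=> -[]; [move=> /adj_irrefl|move=> _ /adj_irrefl]. Qed.

Definition box : sgraph := SGraph box_adj_sym box_adj_irrefl.
End CartesianProduct.

Definition isolated (G : sgraph) (x : G) : Prop := forall y, ~ adj x y.

(* If isolated vertices are allowed in graphs other than K1, the isomorphism of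
   G1 [] G2 with its second clique graph fails: for G1 = 2 K1 and G2 = P3 the
   former is 2 P3, the latter 2 K1. Every connected graph satisfies this
   condition, by connected_isolated_only_K1. *)
Definition isolated_only_K1 (G : sgraph) : Prop :=
  forall x : G, isolated x -> isomorphic G K1.

Definition connected (G : sgraph) : Prop :=
  forall x y : G, clos_refl_trans G (@adj G) x y.

Lemma connected_isolated_only_K1 (G : sgraph) :
  connected G -> isolated_only_K1 G.
Proof.
move=> cG x isox.
have eqx y : y = x.
  case: (clos_rt_rt1n _ _ _ _ (cG x y)) => // z t /isox [].
exists (fun=> tt); split; first by exists (fun=> x) => [y|[]].
by move=> y z; rewrite (eqx y) (eqx z); split=> // /adj_irrefl.
Qed.

(* Main.v *)
(** Every clique of [G1 [] G2] lies in a row or a column and is a clique there,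
    so the product inherits the Helly property from its factors. Moreover a
    vertex [x] of the product with a neighbour in its row and one in its column
    is the only common vertex of the cliques containing it. In a Clique-Helly
    graph with this last property, every pairwise intersecting family of
    cliques is contained in the star of some vertex, and stars are never
    properly nested; hence the cliques of the clique graph are exactly the
    stars, and two stars meet iff their centres are equal or adjacent. *)

From mathcomp Require Import all_boot.
From mathcomp Require Import boolp classical_sets.
Require Import Defs.

Set Implicit Arguments.
Unset Strict Implicit.
Unset Printing Implicit Defensive.

Local Open Scope classical_set_scope.

Lemma clique_helly_vertex (G : sgraph) : clique_helly G -> exists x : G, True.
Proof.
by move=> /(_ set0)[|A B []|x _] //; exists x.
Qed.

Section SecondCliqueGraph.
Variable G : sgraph.

Lemma complete_sub_clique (A : set G) :
  complete A -> exists2 C : set G, clique C & A `<=` C.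
Proof.
move=> cA.
(* The predicate is [complete (A `|` B)] rather than [A `<=` B] plus
   completeness because [Zorn_bigcup] also takes the union of the empty chain. *)
have [F FP totF|M [cM maxM]] := @Zorn_bigcup G [set B | complete (A `|` B)].
  move=> x y [Ax|[X FX Xx]] [Ay|[Y FY Yy]] neq_xy.
  - exact: cA.
  - by apply: (FP _ FY) => //; [left|right].
  - by apply: (FP _ FX) => //; [right|left].
  - have [XY|YX] := totF _ _ FX FY.
      by apply: (FP _ FY) => //; right=> //; exact: XY.
    by apply: (FP _ FX) => //; right=> //; exact: YX.
exists (A `|` M); last by left.
split=> // B cB AMB; apply/seteqP; split=> // x Bx.
have AB : A `|` B = B by apply/setUidPr => a Aa; apply: AMB; left.
apply: contrapT => nAMx; apply: (maxM B); last by rewrite /= AB.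
split; first by move=> a Ma; apply: AMB; right.
by move=> BM; apply: nAMx; right; exact: BM.
Qed.

Lemma complete_edge (x y : G) : adj x y -> complete [set x; y].
Proof.
by move=> xy _ _ [->|->] [->|->] // _; exact: adj_sym.
Qed.

Lemma adj_in_clique (x y : G) :
  adj x y -> exists C : set G, [/\ clique C, C x & C y].
Proof.
move=> /complete_edge /complete_sub_clique[C cC xyC].
by exists C; split=> //; apply: xyC; [left|right].
Qed.

(** The vertex [x] rules out the empty graph, where the empty set is a clique; otherwise a singleton
    properly enlarges it. *)
Lemma clique_neq0 (x : G) (C : set G) : clique C -> C !=set0.
Proof.
move=> [_ maxC]; apply/set0P/eqP => C0; suff : C x by rewrite C0.
by rewrite -(maxC [set x]) ?C0 // => y z -> ->.
Qed.

Definition star (x : G) : set (clique_graph G) := [set C | sval C x].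

Lemma complete_star x : complete (star x).
Proof. by move=> C D Cx Dx neqCD; split=> //; exists x. Qed.

Hypothesis hellyG : clique_helly G.

Lemma complete_sub_star (Q : set (clique_graph G)) :
  complete Q -> exists x, Q `<=` star x.
Proof.
move=> cQ; have clQ : [set sval C | C in Q] `<=` @clique G.
  by move=> _ [C _ <-]; exact: (svalP C).
have [_ _ [C QC <-] [D QD <-]|x Qx] := hellyG clQ.
  (* The Helly property also asks each member to meet itself, that is, to be nonempty. *)
  have [<-|neqCD] := pselect (C = D).
    have [z _] := clique_helly_vertex hellyG.
    have [x Cx] := clique_neq0 z (svalP C).
    by exists x; split.
  by have [] := cQ _ _ QC QD neqCD.
by exists x => C QC; apply: Qx; exists C.
Qed.

Hypothesis sepG :
  forall x y : G, (forall C : set G, clique C -> C x -> C y) -> x = y.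

Lemma star_sub_eq x y : star x `<=` star y -> x = y.
Proof. by move=> xy; apply: sepG => C cC; exact: (xy (exist _ C cC)). Qed.

(** A complete set [Q] above [star x] lies in some [star y], so [star x] lies in [star y]; then
    [x = y], and [Q] is squeezed between equal sets. *)
Lemma clique_star x : clique (star x).
Proof.
split=> [|Q cQ xQ]; first exact: complete_star.
have [y Qy] := complete_sub_star cQ.
have exy : x = y by apply: star_sub_eq => C /xQ /Qy.
by apply/seteqP; split=> //; rewrite exy.
Qed.

Lemma clique_is_star (Q : set (clique_graph G)) :
  clique Q -> exists x, star x = Q.
Proof.
move=> [cQ maxQ]; have [x Qx] := complete_sub_star cQ.
by exists x; apply: maxQ => //; exact: complete_star.
Qed.

Lemma clique_graph2_isomorphic : isomorphic (clique_graph (clique_graph G)) G.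
Proof.
(* The isomorphism [f] sends each clique of the clique graph to the centre of the star that it
   is. *)
have [f fE] := choice (fun Q : clique_graph (clique_graph G) =>
  clique_is_star (svalP Q)).
have fS x : f (exist _ (star x) (clique_star x)) = x.
  by apply: star_sub_eq; rewrite fE.
exists f; split.
  exists (fun x => exist _ (star x) (clique_star x)) => // Q.
  by apply: eq_sig_hprop => [?|]; [exact: Prop_irrelevance|exact: fE].
move=> P Q; split=> [fPQ|[neqPQ]].
  split=> [ePQ|]; first by apply: (@adj_irrefl _ (f P)); rewrite {2}ePQ.
  (* A clique of [G] through the edge joining the two centres is a common element of the two
     stars. *)
  have [C [cC CP CQ]] := adj_in_clique fPQ.
  by exists (exist _ C cC); rewrite -(fE P) -(fE Q).
rewrite -(fE P) -(fE Q) => -[C [CP CQ]]; have [cC _] := svalP C.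
apply: cC => // efPQ; apply: neqPQ.
by apply: eq_sig_hprop => [?|]; [exact: Prop_irrelevance|rewrite -!fE efPQ].
Qed.

End SecondCliqueGraph.

(** * Cliques of the product and its Helly property *)

Section BoxCliques.
Variables G1 G2 : sgraph.
Implicit Types (A : set G1) (B : set G2) (C : set (box G1 G2)).

Definition is_row C :=
  exists (A : set G1) (h : G2), clique A /\ C = A `*` [set h].

Definition is_column C :=
  exists (g : G1) (B : set G2), clique B /\ C = [set g] `*` B.

Lemma complete_row A h : complete (A `*` [set h] : set (box G1 G2)) <-> complete A.
Proof.
split=> [cAh x y Ax Ay neq_xy|cA [x _] [y _] [/= Ax ->] [/= Ay ->] neq_xy].
  have [[]|[_ /adj_irrefl]] // : box_adj (x, h) (y, h) by apply: cAh => // -[].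
by left; split=> //; apply: cA => //= exy; apply: neq_xy; rewrite exy.
Qed.

Lemma complete_column g B :
  complete ([set g] `*` B : set (box G1 G2)) <-> complete B.
Proof.
split=> [cgB x y Bx By neq_xy|cB [_ x] [_ y] [/= -> Bx] [/= -> By] neq_xy].
  have [[/adj_irrefl]|[]] // : box_adj (g, x) (g, y) by apply: cgB => // -[].
by right; split=> //; apply: cB => //= exy; apply: neq_xy; rewrite exy.
Qed.

Lemma clique_row A h : clique (A `*` [set h] : set (box G1 G2)) -> clique A.
Proof.
move=> [/complete_row cA maxA]; split=> // A' cA' AA'.
have eA : A' `*` [set h] = A `*` [set h].
  by apply: maxA; [exact/complete_row|move=> [x y] [/= /AA']].
apply/seteqP; split=> // x A'x.
by have [] : (A `*` [set h]) (x, h) by rewrite -eA.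
Qed.

Lemma clique_column g B : clique ([set g] `*` B : set (box G1 G2)) -> clique B.
Proof.
move=> [/complete_column cB maxB]; split=> // B' cB' BB'.
have eB : [set g] `*` B' = [set g] `*` B.
  by apply: maxB; [exact/complete_column|move=> [x y] [/= ? /BB']].
apply/seteqP; split=> // y B'y.
by have [] : ([set g] `*` B) (g, y) by rewrite -eB.
Qed.

(** Any two vertices of [C] share a coordinate. If some [y] in [C] leaves the row of [(g, h)], then
    [y] is in column [g], and a vertex outside that column would have to lie both in row [h] and in
    the row of [y]. *)
Lemma clique_box C : C !=set0 -> clique C -> is_row C \/ is_column C.
Proof.
move=> [[g h] Cgh] cC; have [compC _] := cC.
have box_eq x y : C x -> C y -> x.1 = y.1 \/ x.2 = y.2.
  move=> Cx Cy; have [->|neq_xy] := pselect (x = y); first by left.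
  by have [[_ ?]|[? _]] := compC _ _ Cx Cy neq_xy; [right|left].
have [rowC|] := pselect (forall x, C x -> x.2 = h).
  left; have eC : C = [set x | C (x, h)] `*` [set h].
    apply/seteqP; split=> [[x y] Cxy|[x y] [/= Cxy ->]//].
    by move: (rowC _ Cxy) => /= eyh; rewrite eyh in Cxy *.
  by exists [set x | C (x, h)], h; split=> //; apply: (@clique_row _ h); rewrite -eC.
move=> /existsNP[y /not_implyP[Cy neq_yh]]; right.
have colC x : C x -> x.1 = g.
  have [] := box_eq _ _ Cy Cgh => //= eyg Cx.
  have [//|/= exh] := box_eq _ _ Cx Cgh.
  have [->//|exy] := box_eq _ _ Cx Cy.
  by case: neq_yh; rewrite -exy.
have eC : C = [set g] `*` [set z | C (g, z)].
  apply/seteqP; split=> [[u v] Cuv|[u v] [/= -> Cuv]//].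
  by move: (colC _ Cuv) => /= eug; rewrite eug in Cuv *.
by exists g, [set z | C (g, z)]; split=> //; apply: (@clique_column g); rewrite -eC.
Qed.

Variable F : set (set (box G1 G2)).
Hypothesis meetF : forall C D, F C -> F D -> (C `&` D) !=set0.

(** Every member meets [C0], so all lie at the same height [h], and the Helly property of [G1]
    applies to their projections. *)
Lemma rows_helly C0 :
  clique_helly G1 -> F C0 -> F `<=` is_row -> (\bigcap_(C in F) C) !=set0.
Proof.
move=> helly1 FC0 rowF; have [A0 [h [_ eC0]]] := rowF _ FC0.
have [|A A' FA FA'|g gP] := helly1 [set A | clique A /\ F (A `*` [set h])].
- by move=> A [].
- by have [[x y] [[/= ? _] [/= ? _]]] := meetF FA.2 FA'.2; exists x.
exists (g, h) => C FC; have [A [h' [cA eC]]] := rowF _ FC.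
have [[x y]] := meetF FC FC0; rewrite eC0 {1}eC => -[[/= _ eyh'] [/= _ eyh]].
have ehh' : h' = h by rewrite -eyh'.
by rewrite eC ehh' in FC *; split=> //; apply: gP.
Qed.

Lemma columns_helly C0 :
  clique_helly G2 -> F C0 -> F `<=` is_column -> (\bigcap_(C in F) C) !=set0.
Proof.
move=> helly2 FC0 colF; have [g [B0 [_ eC0]]] := colF _ FC0.
have [|B B' FB FB'|h hP] := helly2 [set B | clique B /\ F ([set g] `*` B)].
- by move=> B [].
- by have [[x y] [[/= _ ?] [/= _ ?]]] := meetF FB.2 FB'.2; exists y.
exists (g, h) => C FC; have [g' [B [cB eC]]] := colF _ FC.
have [[x y]] := meetF FC FC0; rewrite eC0 {1}eC => -[[/= exg' _] [/= exg _]].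
have egg' : g' = g by rewrite -exg'.
by rewrite eC egg' in FC *; split=> //; apply: hP.
Qed.

(** The common vertex is the crossing [(g, h)] of the row and the column. A row meeting [C0] has
    height [h], so it can meet [C1] only there; columns are symmetric. *)
Lemma row_column_helly C0 C1 : F C0 -> F C1 -> is_row C0 -> is_column C1 ->
  (forall C, F C -> is_row C \/ is_column C) -> (\bigcap_(C in F) C) !=set0.
Proof.
move=> FC0 FC1 [A0 [h [_ eC0]]] [g [B1 [_ eC1]]] rcF.
exists (g, h) => C FC.
have [[x y]] := meetF FC FC0; rewrite eC0 => -[Cxy [/= _ eyh]].
have [[u v]] := meetF FC FC1; rewrite eC1 => -[Cuv [/= eug _]].
rewrite {}eyh in Cxy; rewrite {}eug in Cuv.
have [[A [h' [_ eC]]]|[g' [B [_ eC]]]] := rcF _ FC; subst C.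
  by move: Cxy Cuv => [/= _ ->] [/= ? _].
by move: Cxy Cuv => [/= _ ?] [/= -> _].
Qed.

End BoxCliques.

Lemma clique_helly_box (G1 G2 : sgraph) :
  clique_helly G1 -> clique_helly G2 -> clique_helly (box G1 G2).
Proof.
move=> helly1 helly2 F clF meetF.
have rcF C : F C -> is_row C \/ is_column C.
  move=> FC; apply: clique_box; last exact: clF.
  by have := meetF _ _ FC FC; rewrite setIid.
have [[C0 [FC0 rowC0]]|noRow] := pselect (exists C, F C /\ is_row C).
  have [[C1 [FC1 colC1]]|noCol] := pselect (exists C, F C /\ is_column C).
    exact: (row_column_helly meetF FC0 FC1).
  apply: (rows_helly meetF helly1 FC0) => C FC.
  by have [//|colC] := rcF _ FC; case: noCol; exists C.
have [[C0 FC0]|noF] := pselect (exists C, F C).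
  apply: (columns_helly meetF helly2 FC0) => C FC.
  by have [rowC|//] := rcF _ FC; case: noRow; exists C.
(* The family is empty here, so any vertex of the product will do. *)
have [g _] := clique_helly_vertex helly1.
have [h _] := clique_helly_vertex helly2.
by exists (g, h) => C FC; case: noF; exists C.
Qed.

(** A clique through a row edge at [x] contains two vertices with distinct first coordinates. As [y]
    lies in it and cannot agree with both there, it shares its second coordinate with one of them,
    hence with [x]. A column edge fixes the first coordinate likewise. *)
Lemma box_cliques_separate (G1 G2 : sgraph) :
  (forall g : G1, exists g', adj g g') ->
  (forall h : G2, exists h', adj h h') ->
  forall x y : box G1 G2,
    (forall C : set (box G1 G2), clique C -> C x -> C y) -> x = y.
Proof.
move=> nbr1 nbr2 [g h] [g' h'] xy.
have clique_box_eq C (u v : box G1 G2) :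
    clique C -> C u -> C v -> u.1 = v.1 \/ u.2 = v.2.
  move=> [cC _] Cu Cv; have [->|neq_uv] := pselect (u = v); first by left.
  by have [[_ ?]|[? _]] := cC _ _ Cu Cv neq_uv; [right|left].
have [g1 gg1] := nbr1 g; have [h1 hh1] := nbr2 h.
have [C [cC Cx Cx1]] : exists C : set (box G1 G2),
    [/\ clique C, C (g, h) & C (g1, h)] by apply: adj_in_clique; left.
have [D [cD Dx Dx1]] : exists D : set (box G1 G2),
    [/\ clique D, D (g, h) & D (g, h1)] by apply: adj_in_clique; right.
have Cy := xy C cC Cx; have Dy := xy D cD Dx.
have -> : h = h'.
  have [/= egg'|//] := clique_box_eq _ _ _ cC Cx Cy.
  have [/= eg1|//] := clique_box_eq _ _ _ cC Cx1 Cy.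
  by move: gg1; rewrite egg' eg1 => /adj_irrefl.
have -> // : g = g'.
have [//|/= ehh'] := clique_box_eq _ _ _ cD Dx Dy.
have [//|/= eh1] := clique_box_eq _ _ _ cD Dx1 Dy.
by move: hh1; rewrite ehh' eh1 => /adj_irrefl.
Qed.

Lemma neqK1_neighbour (G : sgraph) :
  ~ isomorphic G K1 -> isolated_only_K1 G -> forall x : G, exists y, adj x y.
Proof.
move=> neqK1 isol x; apply: contrapT => nbr; apply: neqK1; apply: (isol x).
by move=> y xy; apply: nbr; exists y.
Qed.

Theorem theorem3p1 (G1 G2 : sgraph)
    (helly1 : clique_helly G1) (helly2 : clique_helly G2)
    (neqK1_1 : ~ isomorphic G1 K1) (neqK1_2 : ~ isomorphic G2 K1)
    (isol1 : isolated_only_K1 G1) (isol2 : isolated_only_K1 G2) :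
  isomorphic (clique_graph (clique_graph (box G1 G2))) (box G1 G2).
Proof.
apply: clique_graph2_isomorphic; first exact: clique_helly_box.
by apply: box_cliques_separate; exact: neqK1_neighbour.
Qed.
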